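(* Let $n>k>t>j\ge1$ be integers with $n\ge(k-t+1)(t+1)$ and $t+2\le k-t+1$. Suppose that $\mathcal F\subset\binom{[n]}{k}$ is shifted and $t$-intersecting, and $\mathcal F\not\subset\mathcal A_1$. If $$|\mathcal F|>t\binom{n-2k+t}{k-t-1}+\sum_{t+2\le\ell\le k}\binom{2k-t}{\ell-t}\binom{n}{k-\ell},$$ then $$|\partial^j\mathcal F|>\binom{t}{j}|\mathcal F|.$$
   Context: $[n]=\{1,\dots,n\}$, and $\binom{[n]}{k}$ is the collection of all $k$-element subsets of $[n]$. A family $\mathcal F\subset\binom{[n]}{k}$ is $t$-intersecting if $|F\cap F'|\ge t$ for all $F,F'\in\mathcal F$. The $j$'th shadow is $\partial^j\mathcal F=\{G\in\binom{[n]}{k-j} : \exists F\in\mathcal F,\ G\subset F\}$. Shifted: for $k$-sets $A=\{a_1<\dots<a_k\}$, $B=\{b_1<\dots<b_k\}$ write $A\prec B$ iff $a_i\le b_i$ for all $1\le i\le k$; $\mathcal F$ is shifted if $A\prec B$ and $B\in\mathcal F$ always imply $A\in\mathcal F$. $\mathcal A_1=\{A\in\binom{[n]}{k}: |A\cap[t+2]|\ge t+1\}$. *)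

(* Defs.v *)
(* The ground set [n] = {1, ..., n} is represented by 'I_n, the element i : 'I_n
   standing for the integer i + 1. *)
From mathcomp Require Import all_boot.
Set Implicit Arguments.
Unset Strict Implicit.
Unset Printing Implicit Defensive.

Definition ksubsets (n k : nat) : {set {set 'I_n}} :=
  [set A : {set 'I_n} | #|A| == k].

Definition t_intersecting (n t : nat) (F : {set {set 'I_n}}) : Prop :=
  forall A B : {set 'I_n}, A \in F -> B \in F -> t <= #|A :&: B|.

Definition shadow (n k j : nat) (F : {set {set 'I_n}}) : {set {set 'I_n}} :=
  [set G in ksubsets n (k - j) | [exists A in F, G \subset A]].

(* [enum A] lists A in increasing order, so this is a_1 < ... < a_k. *)
Definition elements (n : nat) (A : {set 'I_n}) : seq nat :=
  [seq val i | i <- enum A].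

Lemma elements_sorted (n : nat) (A : {set 'I_n}) : sorted ltn (elements A).
Proof.
rewrite /elements /(enum _) -enumT /=.
apply: (subseq_sorted ltn_trans (s2 := [seq val i | i <- enum 'I_n])).
  by apply: map_subseq; rewrite enumT; exact: filter_subseq.
by rewrite val_enum_ord iota_ltn_sorted.
Qed.

Definition shift_le (n k : nat) (A B : {set 'I_n}) : Prop :=
  forall i : nat, i < k -> nth 0 (elements A) i <= nth 0 (elements B) i.

Definition shifted (n k : nat) (F : {set {set 'I_n}}) : Prop :=
  forall A B : {set 'I_n}, A \in ksubsets n k -> B \in ksubsets n k ->
    shift_le k A B -> B \in F -> A \in F.

Definition initial (n m : nat) : {set 'I_n} := [set i : 'I_n | i < m].

Definition family_A1 (n k t : nat) : {set {set 'I_n}} :=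
  [set A in ksubsets n k | t + 1 <= #|A :&: initial n (t + 2)|].

(* Main.v *)
(* Let N = 2k-t. By shiftedness any two members of F already meet in t elements
   of [N], and every member A has some s <= N for which the walk of A (+1 on
   elements of A, -1 elsewhere) is at height t after s steps. Reflecting the walk
   up to the first such s bounds the number of members with an l-element trace
   on [N] by C(N, l-t) C(n-N, k-l). So the cardinality hypothesis forces a trace
   of size t, or more than t traces of size t+1; since F is not contained in A_1,
   the latter all contain [t]. Hence there is a set Q of more than t points
   outside [t] such that a member not containing [t] misses just one point of
   [t] and contains Q. Members containing [t] have C(t,j) private shadows, the
   others are compensated by removing elements of Q, and one shadow of a trace of
   size t or t+1 is left over. *)
Require Import Defs.
From mathcomp Require Import all_boot zify.
Set Implicit Arguments.
Unset Strict Implicit.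
Unset Printing Implicit Defensive.

(** * The shifting order through counts on initial segments *)

Lemma nth_lt_count (s : seq nat) (i m : nat) :
  sorted ltn s -> i < size s ->
  (nth 0 s i < m) = (i < count (fun x => x < m) s).
Proof.
elim: s i => [|a s IHs] //= i asP.
have sP := path_sorted asP.
have c0 : m <= a -> count (fun x => x < m) s = 0.
  move=> le_ma; apply/eqP; rewrite -leqn0 leqNgt -has_count.
  apply/hasPn => x xs; rewrite -leqNgt; apply: (leq_trans le_ma).
  by move: asP; rewrite path_sortedE;
    [case/andP=> /allP/(_ x xs) /ltnW | exact: ltn_trans].
case: i => [|i] /= i_lt; rewrite ?IHs //; case: (ltnP a m) => // le_ma;
  by rewrite c0.
Qed.

Lemma count_elements (n m : nat) (A : {set 'I_n}) :
  count (fun x => x < m) (elements A) = #|A :&: initial n m|.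
Proof.
rewrite /elements count_map -size_filter cardE /(enum _) -enumT /=.
rewrite -filter_predI /(enum (_ :&: _)) -enumT; congr (size _).
by apply: eq_filter => i; rewrite /= !inE andbC.
Qed.

Lemma size_elements (n : nat) (A : {set 'I_n}) : size (elements A) = #|A|.
Proof. by rewrite size_map -cardE. Qed.

(** Having at least as many elements below every threshold means that the i-th element comes no
    later: take the threshold just after the i-th element of [B]. All later shifting arguments are
    checked in this form. *)
Lemma shift_le_card (n k : nat) (A B : {set 'I_n}) :
  #|A| = k -> #|B| = k ->
  (forall m, #|B :&: initial n m| <= #|A :&: initial n m|) -> shift_le k A B.
Proof.
move=> cA cB leBA i i_lt; rewrite -ltnS nth_lt_count ?elements_sorted //.
  rewrite count_elements; apply: leq_trans (leBA _).
  by rewrite -count_elements -nth_lt_count ?elements_sorted ?size_elements ?cB.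
by rewrite size_elements cA.
Qed.

Lemma card_initial (n m : nat) : m <= n -> #|initial n m| = m.
Proof.
move=> le_mn; rewrite -[RHS](card_ord m).
have -> : initial n m = [set widen_ord le_mn i | i : 'I_m].
  apply/setP => i; rewrite inE; apply/idP/imsetP => [lt_im|[j _ ->]] /=.
    by exists (Ordinal lt_im) => //; apply: val_inj.
  exact: ltn_ord.
rewrite card_imset ?cardsT //; move=> i j /(congr1 val) /= ij; exact: val_inj.
Qed.

Lemma setI_initialT (n m : nat) (A : {set 'I_n}) :
  n <= m -> A :&: initial n m = A.
Proof.
move=> le_nm; apply/setIidPl/subsetP => i _; rewrite inE.
exact: leq_trans (ltn_ord i) le_nm.
Qed.

Lemma card_initialS (n : nat) (A : {set 'I_n}) (i : 'I_n) :
  #|A :&: initial n i.+1| = (i \in A) + #|A :&: initial n i|.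
Proof.
rewrite (cardsD1 i (A :&: initial n i.+1)) !inE ltnSn andbT; congr (_ + #|pred_of_set _|).
apply/setP => x; rewrite !inE ltnS leq_eqVlt -val_eqE /=.
by case: eqP => [->|_] //=; rewrite ltnn andbF.
Qed.

Lemma card_initialS_leq (n m : nat) (A : {set 'I_n}) :
  #|A :&: initial n m.+1| <= #|A :&: initial n m|.+1.
Proof.
case: (ltnP m n) => [lt_mn|le_nm].
  by rewrite (card_initialS A (Ordinal lt_mn)) /=; case: (_ \in _).
by rewrite !setI_initialT // leqW.
Qed.

Lemma card_initial_mono (n m m' : nat) (A : {set 'I_n}) :
  m <= m' -> #|A :&: initial n m| <= #|A :&: initial n m'|.
Proof.
move=> le_m; apply/subset_leq_card/setIS/subsetP => i; rewrite !inE => lt_im.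
exact: leq_trans lt_im le_m.
Qed.

Lemma card_initial_leq (n m : nat) (A : {set 'I_n}) : #|A :&: initial n m| <= m.
Proof.
elim: m => [|m IHm]; last exact: leq_trans (card_initialS_leq _ _) _.
by rewrite leqn0 cards_eq0; apply/eqP/setP => i; rewrite !inE andbF.
Qed.

Definition first_elements (n r : nat) (X : {set 'I_n}) : {set 'I_n} :=
  [set i in X | #|X :&: initial n i| < r].

Lemma card_first_elements_initial (n r m : nat) (X : {set 'I_n}) :
  #|first_elements r X :&: initial n m| = minn r #|X :&: initial n m|.
Proof.
have base (Y : {set 'I_n}) : #|Y :&: initial n 0| = 0.
  by apply/eqP; rewrite -leqn0 card_initial_leq.
elim: m => [|m IHm]; first by rewrite !base minn0.
case: (ltnP m n) => [lt_mn|le_nm].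
  rewrite !(card_initialS _ (Ordinal lt_mn)) IHm inE /=.
  by case: (_ \in X) => //=; lia.
by move: IHm; rewrite !(setI_initialT _ le_nm) !setI_initialT // leqW.
Qed.

Lemma card_first_elements (n r : nat) (X : {set 'I_n}) :
  #|first_elements r X| = minn r #|X|.
Proof.
by have := card_first_elements_initial r n X; rewrite !setI_initialT.
Qed.

(** * Shifted families: exchanges, traces on [2k-t], and walks *)

Lemma shifted_card (n k : nat) (F : {set {set 'I_n}}) (A B : {set 'I_n}) :
  F \subset ksubsets n k -> shifted k F -> B \in F -> #|A| = k ->
  (forall m, #|B :&: initial n m| <= #|A :&: initial n m|) -> A \in F.
Proof.
move=> /subsetP sF shF BF cA leBA; have BK := sF _ BF.
apply: (shF A B) => //; first by rewrite inE cA.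
by apply: shift_le_card => //; apply/eqP; move: BK; rewrite inE.
Qed.

Lemma card_replace (n : nat) (A : {set 'I_n}) (x y : 'I_n) :
  x \in A -> y \notin A -> #|y |: A :\ x| = #|A|.
Proof.
by move=> xA yA; rewrite cardsU1 !inE negb_and yA orbT (cardsD1 x A) xA.
Qed.

(** The exchange raises the counts at thresholds m with y < m <= x and changes no other count. *)
Lemma shifted_replace (n k : nat) (F : {set {set 'I_n}}) (A : {set 'I_n})
    (x y : 'I_n) :
  F \subset ksubsets n k -> shifted k F -> A \in F ->
  x \in A -> y \notin A -> y < x -> y |: A :\ x \in F.
Proof.
move=> sF shF AF xA yA lt_yx; apply: (shifted_card sF shF AF).
  by rewrite card_replace //; move/subsetP: sF => /(_ _ AF); rewrite inE => /eqP.
move=> m; case: (leqP m x) => [le_mx|lt_xm].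
  apply/subset_leq_card/subsetP => z; rewrite !inE => /andP[-> lt_zm].
  by rewrite lt_zm andbT; apply/orP; right; rewrite andbT -val_eqE /=; lia.
have -> : (y |: A :\ x) :&: initial n m = y |: (A :&: initial n m) :\ x.
  apply/setP => z; rewrite !inE; case: eqP => [->|_] //=; last by rewrite andbA.
  exact: ltn_trans lt_xm.
by rewrite card_replace // !inE ?xA ?(negbTE yA).
Qed.

(* While A and B meet beyond 2k-t, some element of [2k-t] is free in both, and
   moving a far common element of A there keeps the trace intersection. *)
Lemma trace_intersecting (n k t : nat) (F : {set {set 'I_n}}) (A B : {set 'I_n}) :
  F \subset ksubsets n k -> shifted k F -> t_intersecting t F ->
  t <= k -> 2 * k - t <= n -> A \in F -> B \in F ->
  t <= #|A :&: B :&: initial n (2 * k - t)|.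
Proof.
move=> sF shF intF le_tk le_Nn AF BF.
have sK C : C \in F -> #|C| = k by move/(subsetP sF); rewrite inE => /eqP.
set N := initial n _.
have [b] := ubnP #|(A :&: B) :\: N|; elim: b A AF => // b IHb A AF lt_b.
have := intF A B AF BF; have := cardsID N (A :&: B).
have [/eqP|[x]] := set_0Vmem ((A :&: B) :\: N).
  by rewrite -cards_eq0 => /eqP ->; lia.
move=> xP cAB tAB; move: (xP); rewrite !inE -leqNgt => /and3P[le_Nx xA xB].
have [y yP|noy] := pickP (mem (N :\: (A :|: B))); last first.
  (* If [A] and [B] cover [N], inclusion-exclusion gives |A∩B∩N| = t - |A\N| - |B\N|, hence |A∩B| <=
     t - |(A∩B)\N| < t, a contradiction. *)
  have sN : N \subset A :|: B.
    by rewrite -setD_eq0; apply/eqP/setP => z; rewrite [LHS]noy inE.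
  have := cardsUI (A :&: N) (B :&: N); rewrite -setIUl (setIidPr sN) -setIIl.
  rewrite card_initial // => cN.
  have := cardsID N A; have := cardsID N B; rewrite (sK A AF) (sK B BF).
  have := subset_leq_card (setSD N (subsetIl A B)).
  have := subset_leq_card (setSD N (subsetIr A B)).
  have : 0 < #|(A :&: B) :\: N| by apply/card_gt0P; exists x.
  by lia.
move: yP; rewrite !inE negb_or => /andP[/andP[yA yB] lt_yN].
have A'F := shifted_replace sF shF AF xA yA (leq_trans lt_yN le_Nx).
have eqAB : (y |: A :\ x) :&: B = (A :&: B) :\ x.
  apply/setP => z; rewrite !inE; case: eqP => [->|_] /=.
    by rewrite (negbTE yB) !andbF.
  by rewrite andbA.
have := IHb _ A'F; rewrite eqAB.
have -> : ((A :&: B) :\ x) :&: N = A :&: B :&: N.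
  apply/setP => z; rewrite !inE; case: eqP => [->|_] //=.
  by rewrite ltnNge le_Nx !andbF.
apply; rewrite setDDl setUC -setDDl; move: lt_b.
by rewrite (cardsD1 x) xP.
Qed.

(* The walk of A (see above) is at height at least t after m steps:
   |A :&: [m]| - (m - |A :&: [m]|) >= t. *)
Definition hits (n t : nat) (A : {set 'I_n}) (m : nat) : bool :=
  m + t <= 2 * #|A :&: initial n m|.

(* Otherwise the first t-1 elements of A together with the first k-t+1
   elements of its complement form a member of F meeting A in t-1 elements. *)
Lemma shifted_hits (n k t : nat) (F : {set {set 'I_n}}) (A : {set 'I_n}) :
  F \subset ksubsets n k -> shifted k F -> t_intersecting t F ->
  0 < t -> t <= k -> 2 * k - t <= n -> A \in F ->
  exists2 m, m <= 2 * k - t & hits t A m.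
Proof.
move=> sF shF intF t_gt0 le_tk le_Nn AF.
have [|nohit] := boolP [exists m : 'I_(2 * k - t).+1, hits t A m].
  by case/existsP => m hm; exists m => //; rewrite -ltnS.
exfalso; move: nohit; rewrite negb_exists => /forallP nohit.
have {}nohit m : m <= 2 * k - t -> 2 * #|A :&: initial n m| < m + t.
  by rewrite -ltnS => lt_m; have := nohit (Ordinal lt_m); rewrite /hits -ltnNge.
have cA : #|A| = k by move/(subsetP sF): AF; rewrite inE => /eqP.
have cC m : m <= n -> #|~: A :&: initial n m| = m - #|A :&: initial n m|.
  move=> le_mn; have := cardsID A (initial n m).
  by rewrite card_initial // setDE [_ :&: A]setIC [_ :&: ~: A]setIC; lia.
pose B := first_elements (t - 1) A :|: first_elements (k - t + 1) (~: A).
have sA : first_elements (t - 1) A \subset A.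
  by apply/subsetP => x; rewrite inE => /andP[].
have sC : first_elements (k - t + 1) (~: A) \subset ~: A.
  by apply/subsetP => x; rewrite inE => /andP[].
have dis : [disjoint first_elements (t - 1) A & first_elements (k - t + 1) (~: A)].
  by apply: (disjointWl sA); rewrite disjoint_sym disjoints_subset.
have {}dis := disjoint_setI0 dis.
have cB m : #|B :&: initial n m| =
    minn (t - 1) #|A :&: initial n m| + minn (k - t + 1) #|~: A :&: initial n m|.
  by rewrite -!card_first_elements_initial setIUl cardsU -setIIl dis set0I cards0 subn0.
have cCN : k - t + 1 <= #|~: A :&: initial n (2 * k - t)|.
  by rewrite cC //; have := nohit _ (leqnn _); lia.
have BF : B \in F.
  apply: (shifted_card sF shF AF).
    have := cB n; rewrite !setI_initialT // cA => ->.
    have := cC n (leqnn n); have := card_initial_mono (~: A) le_Nn.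
    rewrite !(setI_initialT _ (leqnn n)); lia.
  (* No hit at m means that [m] has at least |A∩[m]| - t + 1 points outside [A], enough to replace
     the elements of [A] after the first t-1. By step 2k-t all k-t+1 points of the complement have
     appeared. *)
  move=> m; rewrite cB; case: (leqP m (2 * k - t)) => [le_mN|lt_Nm].
    rewrite cC; last by lia.
    have := nohit _ le_mN.
    have := subset_leq_card (subsetIl A (initial n m)); rewrite cA; lia.
  have := card_initial_mono (~: A) (ltnW lt_Nm).
  have := subset_leq_card (subsetIl A (initial n m)); rewrite cA; lia.
have := intF A B AF BF.
have -> : A :&: B = first_elements (t - 1) A.
  rewrite setIUr (setIidPr sA) (_ : A :&: _ = set0) ?setU0 //.
  by apply/eqP; rewrite setI_eq0 disjoint_sym disjoints_subset.
rewrite card_first_elements; lia.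
Qed.

(** * Reflection of walks at the first hit *)

(** The default n+1 means that no step up to n is a hit. *)
Definition first_hit (n t : nat) (A : {set 'I_n}) : nat :=
  find (hits t A) (iota 0 n.+1).

Lemma first_hitP (n t m : nat) (A : {set 'I_n}) :
  m <= n -> hits t A m ->
  [/\ first_hit t A <= m, hits t A (first_hit t A) &
      forall p, p < first_hit t A -> ~~ hits t A p].
Proof.
move=> le_mn hm.
have hhas : has (hits t A) (iota 0 n.+1).
  by apply/hasP; exists m; rewrite // mem_iota add0n ltnS.
have lt_n : first_hit t A < n.+1 by rewrite -(size_iota 0 n.+1) -has_find.
have before p : p < first_hit t A -> ~~ hits t A p.
  move=> lt_p; have := before_find 0 lt_p.
  by rewrite nth_iota ?add0n ?(ltn_trans lt_p) // => ->.
split=> //.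
  by rewrite leqNgt; apply: contraL hm; exact: before.
by have := nth_find 0 hhas; rewrite nth_iota ?add0n.
Qed.

(** The walk starts at 0 < t and rises by at most 1 per step, so at the first hit its height is
    exactly t. *)
Lemma first_hit_card (n t m : nat) (A : {set 'I_n}) :
  0 < t -> m <= n -> hits t A m ->
  2 * #|A :&: initial n (first_hit t A)| = first_hit t A + t.
Proof.
move=> t_gt0 le_mn /(first_hitP le_mn)[_]; rewrite /hits.
case: (first_hit t A) => [|p] h before.
  by have := card_initial_leq 0 A; lia.
have := before p (ltnSn p); have := card_initialS_leq p A; lia.
Qed.

(** The walk of the mirror image is the walk of [A] negated up to the first hit, where it stands at
    -t, and continued with the same steps. *)
Definition mirror (n t : nat) (A : {set 'I_n}) : {set 'I_n} :=
  (A :\: initial n (first_hit t A)) :|: (initial n (first_hit t A) :\: A).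

Lemma in_mirror (n t : nat) (A : {set 'I_n}) (i : 'I_n) :
  (i \in mirror t A) = (i \in A) (+) (i < first_hit t A).
Proof. by rewrite !inE; case: (i \in A); case: ltnP. Qed.

Lemma card_mirror_initial (n t m : nat) (A : {set 'I_n}) :
  m <= first_hit t A -> m <= n ->
  #|mirror t A :&: initial n m| = m - #|A :&: initial n m|.
Proof.
move=> le_mh le_mn; have := cardsID A (initial n m); rewrite card_initial // [_ :&: A]setIC => cm.
apply/(@addnI #|A :&: initial n m|); rewrite subnKC ?card_initial_leq // -[RHS]cm.
congr (_ + #|pred_of_set _|); apply/setP => i; rewrite in_setI in_mirror !inE.
case: (ltnP i m) => [lt_im|_]; last by rewrite !andbF.
by rewrite (leq_trans lt_im le_mh) addbT.
Qed.

(* Both walks reach their level for the first time at the same step, so that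
   step can be read off the mirror image. *)
Lemma mirror_inj (n t : nat) (A B : {set 'I_n}) (m p : nat) :
  0 < t -> m <= n -> p <= n -> hits t A m -> hits t B p ->
  mirror t A = mirror t B -> A = B.
Proof.
move=> t_gt0.
wlog le_AB : A B m p / first_hit t A <= first_hit t B.
  move=> wl le_m le_p hA hB eqAB.
  case: (leqP (first_hit t A) (first_hit t B)) => [le_AB|/ltnW le_BA].
    exact: (wl A B m p).
  by apply/esym/(wl B A p m).
move=> le_m le_p hA hB eqAB.
have [leA _ _] := first_hitP le_m hA; have eA := first_hit_card t_gt0 le_m hA.
have [_ _ beforeB] := first_hitP le_p hB.
have le_n := leq_trans leA le_m.
have := card_mirror_initial (leqnn _) le_n; rewrite eqAB.
rewrite (card_mirror_initial le_AB le_n) => eqc.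
have eqh : first_hit t A = first_hit t B.
  apply/eqP; rewrite eqn_leq le_AB leqNgt; apply/negP => /beforeB.
  have := card_initial_leq (first_hit t A) A.
  have := card_initial_leq (first_hit t A) B; rewrite /hits; lia.
apply/setP => i; have /setP/(_ i) := eqAB; rewrite !in_mirror eqh.
exact: addIb.
Qed.

Lemma mirror_setD (n t m : nat) (A : {set 'I_n}) :
  first_hit t A <= m -> mirror t A :\: initial n m = A :\: initial n m.
Proof.
move=> le_hm; apply/setP => i; rewrite in_setD in_mirror !inE -leqNgt.
by case: (leqP m i) => //= le_mi; rewrite ltnNge (leq_trans le_hm le_mi) addbF.
Qed.

(** With h the first hit, [A] has (h+t)/2 points in [h] and its mirror image has (h-t)/2; after h
    they agree. *)
Lemma card_mirror_trace (n t m p : nat) (A : {set 'I_n}) :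
  0 < t -> p <= m -> m <= n -> hits t A p ->
  #|mirror t A :&: initial n m| + t = #|A :&: initial n m|.
Proof.
move=> t_gt0 le_pm le_mn hp; have le_pn := leq_trans le_pm le_mn.
have [/leq_trans/(_ le_pm) le_h _ _] := first_hitP le_pn hp.
have eA := first_hit_card t_gt0 le_pn hp.
set h := first_hit t A in le_h eA *.
have split_h (X : {set 'I_n}) : #|X :&: initial n m| =
    #|X :&: initial n h| + #|(X :\: initial n h) :&: initial n m|.
  rewrite -(cardsID (initial n h) (X :&: initial n m)).
  have -> : X :&: initial n m :&: initial n h = X :&: initial n h.
    apply/setP => i; rewrite !inE; case: (ltnP i h) => [lt_ih|]; rewrite ?andbF //.
    by rewrite (leq_trans lt_ih le_h) !andbT.
  by rewrite setIDAC.
rewrite (split_h (mirror t A)) (split_h A) mirror_setD //.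
rewrite (card_mirror_initial (leqnn _) (leq_trans le_h le_mn)) -/h.
have := card_initial_leq h A; lia.
Qed.

(** * Counting members by the size of their trace on [2k-t] *)

Lemma card_split (T : finType) (X : {set T}) (D : {set {set T}})
    (G : {set {set T}}) (b : nat) :
  (forall A, A \in G -> A :&: X \in D /\ #|A :\: X| = b) ->
  #|G| <= #|D| * 'C(#|~: X|, b).
Proof.
move=> sG; rewrite -(cards_draws (~: X) b) -cardsX.
have inj : {in G &, injective (fun A : {set T} => (A :&: X, A :\: X))}.
  by move=> A B _ _ [eqI eqD]; rewrite -(setID A X) eqI eqD setID.
rewrite -(card_in_imset inj); apply/subset_leq_card/subsetP => _ /imsetP[A AG ->].
have [AD cA] := sG A AG; rewrite !inE /= AD cA eqxx andbT.
by rewrite setDE subsetIr.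
Qed.

Lemma card_setC_initial (n m : nat) : m <= n -> #|~: initial n m| = n - m.
Proof.
by move=> le_mn; have := cardsC (initial n m); rewrite card_initial // card_ord; lia.
Qed.

(** Reflection is injective, lowers the trace from l to l-t points and fixes the k-l points outside
    [2k-t]. *)
Lemma card_layer (n k t l : nat) (F : {set {set 'I_n}}) :
  F \subset ksubsets n k -> shifted k F -> t_intersecting t F ->
  0 < t -> t <= k -> 2 * k - t <= n ->
  #|[set A in F | #|A :&: initial n (2 * k - t)| == l]| <=
    'C(2 * k - t, l - t) * 'C(n - (2 * k - t), k - l).
Proof.
move=> sF shF intF t_gt0 le_tk le_Nn; set N := initial n _.
set G := [set A in F | _].
have hitG A : A \in G -> exists2 m, m <= 2 * k - t & hits t A m.
  by rewrite inE => /andP[AF _]; exact: shifted_hits sF shF intF t_gt0 le_tk le_Nn AF.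
have inj : {in G &, injective (mirror t)}.
  move=> A B /hitG[m le_m hm] /hitG[p le_p hp].
  exact: (mirror_inj t_gt0 (leq_trans le_m le_Nn) (leq_trans le_p le_Nn) hm hp).
rewrite -(card_in_imset inj).
rewrite -{1}(card_initial le_Nn) -(card_setC_initial le_Nn) -/N -(cards_draws N).
apply: card_split => _ /imsetP[A AG ->].
have [m le_m hm] := hitG A AG; move: AG; rewrite inE => /andP[AF /eqP cAN].
have [le_h _ _] := first_hitP (leq_trans le_m le_Nn) hm.
have cA : #|A| = k by move/(subsetP sF): AF; rewrite inE => /eqP.
rewrite inE subsetIr /= (mirror_setD (leq_trans le_h le_m)) -/N.
have := card_mirror_trace t_gt0 le_m le_Nn hm.
rewrite -/N cAN -cA -(cardsID N A) cAN => cM.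
by split; [rewrite -cM addnK | rewrite addKn].
Qed.

(** The number of distinct traces is kept in the bound, since for l = t+1 it is the quantity to be
    forced above t. *)
Lemma card_trace_layer (n k l m : nat) (F : {set {set 'I_n}}) :
  F \subset ksubsets n k -> m <= n ->
  #|[set A in F | #|A :&: initial n m| == l]| <=
    #|[set A :&: initial n m | A in [set A in F | #|A :&: initial n m| == l]]|
      * 'C(n - m, k - l).
Proof.
move=> sF le_mn; rewrite -(card_setC_initial le_mn).
apply: card_split => A AG; split; first exact: imset_f.
move: AG; rewrite inE => /andP[/(subsetP sF)]; rewrite inE => /eqP <- /eqP <-.
by rewrite -(cardsID (initial n m) A) addKn.
Qed.

Lemma card_layers (T : finType) (F : {set T}) (f : T -> nat) (k : nat) :
  (forall x, x \in F -> f x <= k) ->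
  #|F| = \sum_(0 <= l < k.+1) #|[set x in F | f x == l]|.
Proof.
move=> le_f; rewrite -sum1_card big_mkord.
rewrite (partition_big (fun x => inord (f x) : 'I_k.+1) predT) //=.
apply: eq_bigr => l _; rewrite -sum1_card; apply: eq_bigl => x; rewrite inE.
case xF: (x \in F) => //=; rewrite -val_eqE /= inordK // ltnS; exact: le_f.
Qed.

Lemma initial_subset (n m : nat) (A : {set 'I_n}) :
  m <= n -> m <= #|A :&: initial n m| -> initial n m \subset A.
Proof.
move=> le_mn le_m; apply/setIidPr/eqP.
by rewrite eqEcard subsetIr card_initial.
Qed.

(** If both alternatives fail, the layers up to t are empty (a member meets itself in t points of
    [2k-t]), layer t+1 gives at most the first term of the bound, and reflection bounds the layers
    from t+2 on by the sum. *)
Lemma trace_layer_dichotomy (n k t : nat) (F : {set {set 'I_n}}) :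
  F \subset ksubsets n k -> shifted k F -> t_intersecting t F ->
  0 < t -> t < k -> 2 * k - t <= n ->
  t * 'C(n - (2 * k - t), k - t - 1)
    + \sum_(t + 2 <= l < k.+1) 'C(2 * k - t, l - t) * 'C(n, k - l) < #|F| ->
  (exists2 A, A \in F & #|A :&: initial n (2 * k - t)| = t) \/
  t < #|[set A :&: initial n (2 * k - t) | A in
           [set A in F | #|A :&: initial n (2 * k - t)| == t.+1]]|.
Proof.
move=> sF shF intF t_gt0 lt_tk le_Nn hcard.
set N := initial n _; pose layer l := [set A in F | #|A :&: N| == l].
have trace_ge A : A \in F -> t <= #|A :&: N|.
  move=> AF.
  have := trace_intersecting sF shF intF (ltnW lt_tk) le_Nn AF AF.
  by rewrite setIid.
have trace_le A : A \in F -> #|A :&: N| <= k.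
  move=> AF; apply: leq_trans (subset_leq_card (subsetIl _ _)) _.
  by move/(subsetP sF): AF; rewrite inE => /eqP ->.
have [no_t|[A]] := set_0Vmem (layer t); last first.
  by rewrite inE => /andP[AF /eqP cA]; left; exists A.
rewrite /layer in no_t; right; rewrite ltnNge; apply/negP => few; move: hcard; rewrite ltnNge => /negP.
apply; rewrite (card_layers trace_le).
have le_t2 : t + 2 <= k.+1 by rewrite addn2.
rewrite (big_cat_nat (leq0n _) le_t2) /=.
apply: leq_add; last first.
  apply: leq_sum => l _; apply: leq_trans (card_layer _ sF shF intF t_gt0 (ltnW lt_tk) le_Nn) _.
  by rewrite leq_mul2l leq_bin2l ?leq_subr // orbT.
rewrite [t + 2]addn2 !big_nat_recr //= no_t cards0 addn0 big_nat big1 ?add0n => [|l /andP[_ lt_lt]].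
  apply: leq_trans (card_trace_layer _ sF le_Nn) _.
  by rewrite -/N subnS subn1 leq_mul2r few orbT.
apply/eqP; rewrite cards_eq0; apply/eqP/setP => A; rewrite !inE.
by apply/negP => /andP[/trace_ge le_t /eqP e]; rewrite e leqNgt lt_lt in le_t.
Qed.

(** * Small traces form a sunflower with kernel [t] *)

(** A hit m of [A] satisfies m + t <= 2(t+1). If m <= t+1, it forces [t] into [A]. If m = t+2, the
    whole trace of [A] lies in [t+2], and a point of [t] missing from [A] lets [B] be shifted to a
    member meeting this trace in fewer than t points. *)
Lemma trace_succ_sub (n k t : nat) (F : {set {set 'I_n}}) (A B : {set 'I_n}) :
  F \subset ksubsets n k -> shifted k F -> t_intersecting t F ->
  0 < t -> t + 2 <= k -> 2 * k - t <= n -> A \in F -> B \in F ->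
  #|A :&: initial n (2 * k - t)| = t.+1 -> #|B :&: initial n (t + 2)| <= t ->
  initial n t \subset A.
Proof.
move=> sF shF intF t_gt0 le_t2k le_Nn AF BF cAN cBP.
have le_tk : t <= k by lia.
set N := initial n (2 * k - t) in cAN; set P := initial n (t + 2) in cBP.
have [m le_m hm] := shifted_hits sF shF intF t_gt0 le_tk le_Nn AF.
have le_mA := card_initial_leq m A; have le_AN := card_initial_mono A le_m.
rewrite /hits in hm; rewrite -/N cAN in le_AN.
have [le_mt|lt_tm] := leqP m t.+1.
  apply: initial_subset; first by lia.
  have [lt_mt|le_tm] := leqP m t.
    by have := card_initial_mono A lt_mt; lia.
  have e : m = t.+1 by lia.
  by have := card_initialS_leq t A; rewrite -e; lia.
have e : m = t + 2 by lia.
rewrite e -/P in le_mA le_AN hm.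
have cAP : #|A :&: P| = t.+1 by lia.
have sPN : P \subset N by apply/subsetP => x; rewrite !inE; lia.
have eqAPN : A :&: P = A :&: N.
  by apply/eqP; rewrite eqEcard cAN cAP leqnn setIS.
apply/subsetP => i; rewrite inE => lt_it; apply: contraT => iA.
have cABN C : C \in F -> t <= #|A :&: P :&: C|.
  move=> CF; rewrite eqAPN setIAC; exact: trace_intersecting sF shF intF _ _ AF CF.
have sABP : A :&: P :&: B \subset B :&: P by rewrite -setIA setIC [B :&: P]setIC subsetIl.
have eqABP : A :&: P :&: B = B :&: P.
  by apply/eqP; rewrite eqEcard sABP (leq_trans cBP) // cABN.
have iB : i \notin B.
  apply: contra iA => iB; have : i \in B :&: P by rewrite !inE iB; lia.
  by rewrite -eqABP !inE => /andP[/andP[]].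
(* [B] has t points in [t+2], all in [A]; as i is not among them, they do not fit into [t] and some
   x lies beyond. *)
have [x xP|nox] := pickP [pred x in B :&: P | t <= x]; last first.
  have : B :&: P \subset initial n t :\ i.
    apply/subsetP => x xBP; have := nox x; rewrite /= xBP /= => /negbT.
    rewrite -ltnNge !inE => ->; rewrite andbT; apply: contraNneq iB => <-.
    by move: xBP; rewrite inE => /andP[].
  move/subset_leq_card; rewrite -eqABP => le_c; have := leq_trans (cABN B BF) le_c.
  have le_tn : t <= n by lia.
  by have := cardsD1 i (initial n t); rewrite card_initial // inE lt_it; lia.
move: xP => /= /andP[xBP le_tx]; move: (xBP); rewrite inE => /andP[xB _].
(* Trading x for i loses a common point with [A] and gains none. *)
have CF := shifted_replace sF shF BF xB iB (leq_trans lt_it le_tx).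
have : A :&: P :&: (i |: B :\ x) \subset (B :&: P) :\ x.
  apply/subsetP => z; rewrite -eqABP !inE => /andP[/andP[zA ->]].
  case: eqP => [zi|_] /=; first by rewrite -zi zA in iA.
  by case/andP=> -> ->; rewrite zA.
move/subset_leq_card/(leq_trans (cABN _ CF)) => le_t.
by move: cBP; rewrite (cardsD1 x) xBP add1n ltnNge le_t.
Qed.

(* [t] is the kernel and Q the set of petals of a sunflower of traces of size
   t+1; if some trace is [t] itself, any Q in [2k-t] outside [t] will do. *)
Lemma exists_sunflower (n k t : nat) (F : {set {set 'I_n}}) :
  F \subset ksubsets n k -> shifted k F -> t_intersecting t F ->
  0 < t -> 2 * t < k -> 2 * k - t <= n ->
  (exists2 B, B \in F & #|B :&: initial n (t + 2)| <= t) ->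
  t * 'C(n - (2 * k - t), k - t - 1)
    + \sum_(t + 2 <= l < k.+1) 'C(2 * k - t, l - t) * 'C(n, k - l) < #|F| ->
  exists Q A0 : {set 'I_n}, [/\ t < #|Q|, [disjoint Q & initial n t],
    [/\ A0 \in F, initial n t \subset A0 & #|A0 :&: Q| <= 1] &
    forall B, B \in F -> initial n t \subset B \/
      #|initial n t :\: B| = 1 /\ Q \subset B].
Proof.
move=> sF shF intF t_gt0 lt_2tk le_Nn [B0 B0F cB0] hcard.
have le_tk : t <= k by lia.
have le_tn : t <= n by lia.
have cross := trace_intersecting sF shF intF le_tk le_Nn.
have := trace_layer_dichotomy sF shF intF t_gt0 _ le_Nn hcard.
set N := initial n (2 * k - t) in cross *; set T := initial n t.
have cN : #|N| = 2 * k - t by exact: card_initial.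
have cT : #|T| = t by exact: card_initial.
have sTN : T \subset N by apply/subsetP => x; rewrite !inE; lia.
case=> [|[A AF cA]|many]; first by lia.
  have [m le_m hm] := shifted_hits sF shF intF t_gt0 le_tk le_Nn AF.
  have le_mA := card_initial_leq m A; have le_AN := card_initial_mono A le_m.
  rewrite /hits in hm; rewrite -/N cA in le_AN.
  (* Both m and t bound |A∩[m]|, so m + t <= 2|A∩[m]| forces m = t. *)
  have e : m = t by lia.
  have sTA : T \subset A by apply: initial_subset => //; rewrite e in hm; lia.
  have eqAN : A :&: N = T.
    by apply/esym/eqP; rewrite eqEcard subsetI sTA sTN cA cT leqnn.
  exists (N :\: T), A; split.
  - by rewrite cardsD (setIidPr sTN) cN cT; lia.
  - by rewrite disjoints_subset setDE subsetIr.
  - split=> //; rewrite setIDA eqAN setDv cards0 //.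
  move=> B BF; left; apply: initial_subset => //.
  by have := cross _ _ AF BF; rewrite setIAC eqAN setIC.
pose G := [set A in F | #|A :&: N| == t.+1].
have TG A : A \in G -> [/\ A \in F, T \subset A & #|A :&: N| = t.+1].
  rewrite inE => /andP[AF /eqP cA]; split=> //.
  by apply: (trace_succ_sub sF shF intF t_gt0 _ le_Nn AF B0F cA cB0); lia.
pose Q := (\bigcup_(A in G) (A :&: N)) :\: T.
have sAQ A : A \in G -> A :&: N :\: T \subset Q.
  by move=> AG; apply/setSD/subsetP => z zA; apply/bigcupP; exists A.
have cAT A : A \in G -> #|A :&: N :\: T| = 1.
  case/TG=> _ sTA cA.
  by rewrite cardsD (setIidPr (_ : T \subset A :&: N)) ?subsetI ?sTA // cA cT subSnn.
have QE q : q \in Q -> exists2 A, A \in G & q \in A :&: N :\: T.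
  by rewrite inE => /andP[qT /bigcupP[A AG qA]]; exists A; rewrite // inE qT.
have [A0 A0G] : exists A, A \in G.
  by move: (leq_ltn_trans (leq0n _) many) => /card_gt0P[_ /imsetP[A AG _]]; exists A.
have [A0F sTA0 cA0] := TG _ A0G.
have sQN : Q \subset N.
  by apply/subsetP => q /QE[A _]; rewrite !inE => /and3P[].
exists Q, A0; split.
- apply: leq_trans many _.
  (* Each trace of size t+1 is [t] plus one petal, so there are at least as many petals as
     traces. *)
  apply: leq_trans (leq_imset_card (fun q => q |: T) Q).
  apply/subset_leq_card/subsetP => _ /imsetP[A AG ->].
  have /cards1P[q eqq] : #|A :&: N :\: T| == 1 by rewrite cAT.
  apply/imsetP; exists q; first by apply: (subsetP (sAQ A AG)); rewrite eqq set11.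
  have [_ sTA _] := TG A AG.
  by rewrite -eqq setUC -[LHS](setID _ T) (setIidPr (_ : T \subset A :&: N)) // subsetI sTA.
- by rewrite disjoints_subset /Q setDE subsetIr.
- split=> //; rewrite -(cAT _ A0G) subset_leq_card //; apply/subsetP => q.
  rewrite in_setI => /andP[qA qQ]; rewrite in_setD in_setI qA (subsetP sQN) //.
  by move: qQ; rewrite in_setD /= andbT => /andP[].
move=> B BF; have [sTB|/subsetPn[i iT iB]] := boolP (T \subset B); first by left.
right.
(* A trace of t+1 points meets [B] in at least t, so [B] misses at most one of them; i is already
   one. *)
have missing A z : A \in G -> z \in A :&: N -> z \notin B -> z = i.
  move=> AG zA zB; have [AF sTA cA] := TG A AG.
  have /card_le1_eqP : #|A :&: N :\: B| <= 1.
    rewrite -(leq_add2l t) addn1 -cA -(cardsID B (A :&: N)) leq_add2r.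
    by rewrite setIAC; exact: cross.
  by apply; rewrite in_setD ?zB ?zA // iB in_setI (subsetP sTA) // (subsetP sTN).
have TB z : z \in T -> z \notin B -> z = i.
  move=> zT; apply: missing A0G _.
  by rewrite inE (subsetP sTA0) // (subsetP sTN).
split.
  apply/eqP/cards1P; exists i; apply/setP => z; rewrite in_setD in_set1.
  apply/andP/eqP => [[zB zT]|->]; [exact: TB | by []].
apply/subsetP => q /QE[A AG]; rewrite in_setD => /andP[qT qA].
by apply: contraNT qT => qB; rewrite (missing A q).
Qed.

(** * Shadows obtained by removing subsets of a fixed set *)

Lemma setD_in_shadow (n k j : nat) (F : {set {set 'I_n}}) (A J : {set 'I_n}) :
  F \subset ksubsets n k -> A \in F -> J \subset A -> #|J| = j ->
  A :\: J \in shadow k j F.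
Proof.
move=> sF AF sJA cJ; rewrite !inE cardsD (setIidPr sJA) cJ.
have := subsetP sF A AF; rewrite inE => /eqP ->; rewrite eqxx.
by apply/exists_inP; exists A; rewrite // subsetDl.
Qed.

Definition removals (T : finType) (X : {set T}) (j : nat) (G : {set {set T}}) :
    {set {set T}} :=
  [set p.1 :\: p.2 | p in setX G [set J : {set T} | J \subset X & #|J| == j]].

Lemma removalsP (T : finType) (X : {set T}) (j : nat) (G : {set {set T}})
    (B : {set T}) :
  reflect (exists A J : {set T}, [/\ A \in G, J \subset X, #|J| = j & B = A :\: J])
    (B \in removals X j G).
Proof.
apply: (iffP imsetP) => [[[A J]]|[A [J [AG sJ cJ ->]]]].
  by rewrite !inE /= => /and3P[AG sJ /eqP cJ] ->; exists A, J.
by exists (A, J); rewrite // !inE /= AG sJ cJ eqxx.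
Qed.

(** Both parts of a pair are recovered from D = A \ J: J is X \ D and A is the union of D and X. *)
Lemma card_removals (T : finType) (X : {set T}) (j : nat) (G : {set {set T}}) :
  (forall A, A \in G -> X \subset A) -> #|removals X j G| = #|G| * 'C(#|X|, j).
Proof.
move=> sXG; rewrite card_in_imset ?cardsX ?cards_draws // => -[A J] [B K].
rewrite !inE /= => /and3P[/sXG sXA sJX _] /and3P[/sXG sXB sKX _] eqD.
have rec (C L : {set T}) : X \subset C -> L \subset X ->
    L = X :\: (C :\: L) /\ C = C :\: L :|: X.
  move=> sXC sLX; split; apply/setP => z; have := subsetP sXC z;
    have := subsetP sLX z; rewrite !inE;
    case: (z \in L); case: (z \in X); case: (z \in C) => //= h1 h2;
    try (by have := h1 isT); by have := h2 isT.
have [eJ eA] := rec A J sXA sJX; have [eK eB] := rec B K sXB sKX.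
by rewrite eqD -eB in eA; rewrite eqD -eK in eJ; rewrite eA eJ.
Qed.

Lemma exists_subset_between (T : finType) (X Y : {set T}) (j : nat) :
  X \subset Y -> #|X| <= j -> j <= #|Y| ->
  exists J : {set T}, [/\ X \subset J, J \subset Y & #|J| = j].
Proof.
move=> sXY le_Xj le_jY.
have : 0 < #|[set J : {set T} | J \subset Y :\: X & #|J| == j - #|X|]|.
  by rewrite cards_draws bin_gt0 cardsD (setIidPr sXY) leq_sub2r.
case/card_gt0P => J; rewrite inE => /andP[sJ /eqP cJ].
exists (X :|: J); split; first exact: subsetUl.
  by rewrite subUset sXY (subset_trans sJ) ?subsetDl.
rewrite cardsU cJ (_ : X :&: J = set0) ?cards0; first by lia.
apply/eqP; rewrite setI_eq0 disjoint_sym.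
by apply: (disjointWl sJ); rewrite disjoints_subset setDE subsetIr.
Qed.

(* A member containing T has shadows meeting T in |T|-j points, one for each
   j-subset of T; E pays for the other members; and A0 yields one shadow more. *)
Lemma shadow_card_gt (n k j : nat) (F E : {set {set 'I_n}}) (T Q A0 : {set 'I_n}) :
  F \subset ksubsets n k -> 0 < j -> #|T| + j <= k -> j <= #|T| ->
  [disjoint Q & T] -> A0 \in F -> T \subset A0 -> #|A0 :&: Q| <= 1 ->
  E \subset shadow k j F ->
  (forall G, G \in E ->
     #|G :&: T| != #|T| - j /\ ~~ ((T \subset G) && [disjoint G & Q])) ->
  'C(#|T|, j) * #|[set A in F | ~~ (T \subset A)]| <= #|E| ->
  'C(#|T|, j) * #|F| < #|shadow k j F|.
Proof.
move=> sF j_gt0 le_k le_jT dQT A0F sTA0 cA0Q sE EP leE.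
pose F0 := [set A in F | T \subset A].
have cA0 : #|A0| = k by move/(subsetP sF): A0F; rewrite inE => /eqP.
(* [J] absorbs the at most one point of [A0] in [Q] and avoids [T]. So [G0] contains [T] and misses
   [Q], which keeps it out of [E] and out of the removals from [T]. *)
have [J [sQJ sJ cJ]] : exists J : {set 'I_n},
    [/\ A0 :&: Q \subset J, J \subset A0 :\: T & #|J| = j].
  apply: exists_subset_between; last 1 first.
  - by rewrite cardsD (setIidPr sTA0) cA0; lia.
  - apply/subsetP => z; rewrite inE => /andP[zA zQ].
    by rewrite inE zA (disjointFr dQT zQ).
  - exact: leq_trans j_gt0.
pose G0 := A0 :\: J.
have sTG0 : T \subset G0.
  apply/subsetP => z zT; rewrite inE (subsetP sTA0) // andbT.
  by apply/negP => /(subsetP sJ); rewrite inE zT.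
have dG0 : [disjoint G0 & Q].
  rewrite disjoints_subset; apply/subsetP => z; rewrite !inE => /andP[zJ zA].
  by apply: contra zJ => zQ; apply: (subsetP sQJ); rewrite inE zA.
have R0P G : G \in removals T j F0 -> #|G :&: T| = #|T| - j.
  case/removalsP => A [L [AF0 sLT cL ->]]; move: AF0; rewrite inE => /andP[_ sTA].
  by rewrite setIDAC (setIidPr sTA) cardsD (setIidPr sLT) cL.
have G0E : G0 \notin E.
  by apply/negP => /EP[_]; rewrite sTG0 dG0.
have G0R : G0 \notin removals T j F0.
  apply/negP => /R0P; rewrite (setIidPr sTG0) => e.
  by have := ltn_subrL j #|T|; rewrite -e ltnn j_gt0 (leq_trans j_gt0 le_jT).
have ER : E :&: removals T j F0 = set0.
  apply/eqP; rewrite -subset0; apply/subsetP => G; rewrite inE => /andP[/EP[h _] /R0P h'].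
  by rewrite h' eqxx in h.
have sub : G0 |: (E :|: removals T j F0) \subset shadow k j F.
  rewrite !subUset sE sub1set /= (setD_in_shadow sF) ?(subset_trans sJ) ?subsetDl //=.
  apply/subsetP => _ /removalsP[A [L [AF0 sLT cL ->]]].
  move: AF0; rewrite inE => /andP[AF sTA].
  exact: setD_in_shadow (subset_trans sLT sTA) cL.
apply: leq_trans (subset_leq_card sub).
rewrite cardsU1 inE negb_or G0E G0R cardsU ER cards0 subn0.
rewrite card_removals => [|A]; last by rewrite inE => /andP[].
have -> : #|F| = #|[set A in F | ~~ (T \subset A)]| + #|F0|.
  rewrite -(cardsID F0 F) addnC; congr (_ + _); apply: eq_card => A; rewrite !inE;
    by case: (A \in F); rewrite ?andbT ?andbF.
by rewrite mulnDr [#|F0| * _]mulnC add1n ltnS leq_add2r.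
Qed.

(** * Extra shadows from the members that miss a point of [t] *)

(** Removing j petals leaves |T|-1 points of [T]; this differs from |T|-j because j >= 2, so the
    case j = 1 needs another construction. *)
Lemma extra_shadows_ge2 (n k j : nat) (F : {set {set 'I_n}}) (T Q : {set 'I_n}) :
  F \subset ksubsets n k -> 1 < j -> j <= #|T| -> #|T| <= #|Q| ->
  [disjoint Q & T] ->
  (forall B, B \in F -> T \subset B \/ #|T :\: B| = 1 /\ Q \subset B) ->
  exists E : {set {set 'I_n}}, [/\ E \subset shadow k j F,
    forall G, G \in E ->
      #|G :&: T| != #|T| - j /\ ~~ ((T \subset G) && [disjoint G & Q]) &
    'C(#|T|, j) * #|[set A in F | ~~ (T \subset A)]| <= #|E|].
Proof.
move=> sF j_gt1 le_jT le_TQ dQT hF; set F1 := [set A in F | _].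
have F1P A : A \in F1 -> [/\ A \in F, ~~ (T \subset A), #|T :\: A| = 1 & Q \subset A].
  by rewrite inE => /andP[AF nTA]; case: (hF A AF) => [TA|[]]; rewrite ?TA // in nTA *.
exists (removals Q j F1); split.
- apply/subsetP => _ /removalsP[A [J [/F1P[AF _ _ sQA] sJQ cJ ->]]].
  exact: setD_in_shadow (subset_trans sJQ sQA) cJ.
- move=> _ /removalsP[A [J [/F1P[_ nTA cTA _] sJQ _ ->]]]; split; last first.
    apply: contra nTA => /andP[sT _]; apply: subset_trans sT _; exact: subsetDl.
  have -> : (A :\: J) :&: T = T :&: A.
    apply/setP => z; rewrite !inE; case zT: (z \in T); rewrite ?andbF ?andbT //=.
    suff -> : z \notin J by [].
    by apply/negP => /(subsetP sJQ) zQ; rewrite (disjointFr dQT zQ) in zT.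
  have eT := cardsID A T; rewrite cTA in eT.
  rewrite -eT addn1; apply/eqP; rewrite -eT addn1 in le_jT; lia.
- rewrite mulnC card_removals => [|A /F1P[] //].
  by rewrite leq_mul2l leq_bin2l ?orbT.
Qed.

(* The members missing a point of T = [t] are paid for as follows. Let A miss
   only i and let x be in T. If x < i the shadow is A \ {x}; otherwise it is
   A with i added and the petals q_i, q_{x+1} removed. Since i < x + 1, both
   T \ {i,x} in the first case and {q_i, q_{x+1}} in the second case
   determine i and x. *)
Lemma extra_shadows_1 (n k t : nat) (F : {set {set 'I_n}}) (Q : {set 'I_n}) :
  F \subset ksubsets n k -> shifted k F -> 1 < t -> t <= n -> t < #|Q| ->
  [disjoint Q & initial n t] ->
  (forall B, B \in F -> initial n t \subset B \/
    #|initial n t :\: B| = 1 /\ Q \subset B) ->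
  exists E : {set {set 'I_n}}, [/\ E \subset shadow k 1 F,
    forall G, G \in E ->
      #|G :&: initial n t| != t - 1 /\
      ~~ ((initial n t \subset G) && [disjoint G & Q]) &
    t * #|[set A in F | ~~ (initial n t \subset A)]| <= #|E|].
Proof.
move=> sF shF t_gt1 le_tn lt_tQ dQT hF.
have t_neq : t != t - 1 by lia.
(* As t >= 2, there are at least three petal indices 0..t; a petal other than q_i and q_{x+1}
   survives, so a shadow of the second kind still meets [Q]. *)
have other (i x : nat) : exists a, [/\ a <= t, a != i & a != x.+1].
  have [->|i0] := eqVneq i 0; last by exists 0; rewrite eq_sym.
  by have [->|x0] := eqVneq x 0; [exists 2 | exists 1]; split; lia.
set T := initial n t in dQT hF *.
set F1 := [set A in F | _].
have cT : #|T| = t by exact: card_initial.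
have [q0 q0Q] : exists q0, q0 \in Q.
  by apply/card_gt0P; exact: leq_ltn_trans lt_tQ.
(* The default [q0] is never reached: only indices a <= t < |Q| occur. *)
pose q a := nth q0 (enum Q) a.
have qQ a : a <= t -> q a \in Q.
  by move=> le_at; rewrite -mem_enum mem_nth // -cardE (leq_ltn_trans le_at).
have qI a b : a <= t -> b <= t -> q a = q b -> a = b.
  move=> le_at le_bt /eqP.
  by rewrite nth_uniq ?enum_uniq -?cardE ?(leq_ltn_trans _ lt_tQ) // => /eqP.
have QT z : z \in Q -> (z \in T) = false by move/(disjointFr dQT).
pose hole A := odflt q0 [pick i in T :\: A].
have holeP A : A \in F1 -> [/\ A \in F, T :\: A = [set hole A] & Q \subset A].
  rewrite inE => /andP[AF nTA]; case: (hF A AF) => [TA|[c sQA]].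
    by rewrite TA in nTA.
  split=> //; move/eqP/cards1P: c => [i ei]; rewrite /hole ei.
  by case: pickP => [z|/(_ i)]; rewrite ?inE ?eqxx // => /eqP ->.
have holeT A : A \in F1 -> hole A \in T.
  case/holeP=> _ e _; have : hole A \in T :\: A by rewrite e set11.
  by rewrite inE => /andP[].
have holeA A : A \in F1 -> hole A \notin A.
  case/holeP=> _ e _; have : hole A \in T :\: A by rewrite e set11.
  by rewrite inE => /andP[].
have inA A z : A \in F1 -> z \in T -> z != hole A -> z \in A.
  case/holeP=> _ e _ zT; apply: contraNT => zA.
  have : z \in T :\: A by rewrite inE zA.
  by rewrite e inE.
have ltT z : z \in T -> z < t by rewrite inE.
pose psi (p : {set 'I_n} * 'I_n) := let i := hole p.1 in
  if p.2 < i then p.1 :\ p.2 else (i |: p.1) :\: [set q i; q p.2.+1].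
(* Whether the shadow contains [T] tells the two kinds apart. *)
have psiT A x : A \in F1 -> x \in T -> (T \subset psi (A, x)) = ~~ (x < hole A).
  move=> AF1 xT; rewrite /psi /=; case: ifP => lt_xi.
    by apply/negP => /subsetP/(_ x xT); rewrite !inE eqxx.
  apply/subsetP => z zT; rewrite !inE.
  have nq a : a <= t -> z != q a.
    by move=> /qQ/QT qT; apply: contraTneq zT => ->; rewrite qT.
  rewrite (negbTE (nq _ (ltnW (ltT _ (holeT _ AF1))))) (negbTE (nq _ (ltT _ xT))) /=.
  by case: eqP => //= /eqP; exact: inA.
exists [set psi p | p in setX F1 T]; split.
- apply/subsetP => _ /imsetP[[A x] AxX ->].
  have /andP[/= AF1 xT] : (A \in F1) && (x \in T) by rewrite in_setX in AxX.
  have [AF _ sQA] := holeP A AF1; have iT := holeT A AF1; have iA := holeA A AF1.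
  rewrite /psi /=; case: ifP => lt_xi.
    apply: (setD_in_shadow sF AF); last exact: cards1.
    rewrite sub1set; apply: inA => //; apply: contraTneq lt_xi => ->.
    by rewrite ltnn.
  have le_it := ltnW (ltT _ iT); have qiQ := qQ _ le_it.
  have qiA := subsetP sQA _ qiQ.
  have lt_iq : hole A < q (hole A).
    rewrite (leq_trans (ltT _ iT)) // leqNgt.
    by have := QT _ qiQ; rewrite inE => ->.
  have neq : q x.+1 != q (hole A).
    by apply/eqP => /(qI _ _ (ltT _ xT) le_it) e; rewrite -e ltnSn in lt_xi.
  (* The petal q_i lies beyond [t], so shifting it to the hole i stays in [F]; removing q_{x+1},
     distinct from q_i since i <= x, then gives the shadow. *)
  have A'F := shifted_replace sF shF AF qiA iA lt_iq.
  have -> : (hole A |: A) :\: [set q (hole A); q x.+1] =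
      (hole A |: A :\ q (hole A)) :\: [set q x.+1].
    apply/setP => z; rewrite !inE; case: (z =P hole A) => [->|_] /=.
      rewrite andbT negb_or; case: eqP => [e|_]; last by rewrite andbT.
      by rewrite -e ltnn in lt_iq.
    by case: (z == q (hole A)); case: (z == q x.+1); rewrite ?andbF.
  apply: (setD_in_shadow sF A'F); last exact: cards1.
  by rewrite sub1set !inE neq (subsetP sQA) ?orbT // qQ // ltT.
- move=> _ /imsetP[[A x] AxX ->].
  have /andP[/= AF1 xT] : (A \in F1) && (x \in T) by rewrite in_setX in AxX.
  have iT := holeT A AF1; have iA := holeA A AF1; have [_ _ sQA] := holeP A AF1.
  rewrite psiT //; have [lt_xi|le_ix] := ltnP x (hole A); split=> //=.
  (* A shadow of the first kind misses both the hole and x, leaving t-2 points of [T]. *)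
  + have -> : psi (A, x) :&: T = T :\ hole A :\ x.
      rewrite /psi /= lt_xi; apply/setP => z; rewrite !inE.
      case: (z =P hole A) => [->|/eqP zi]; first by rewrite (negbTE iA) !andbF.
      case zT: (z < t); rewrite ?andbF //= !andbT.
      by rewrite (inA _ _ AF1) ?andbT // inE.
    have xi : x != hole A by apply: contraTneq lt_xi => ->; rewrite ltnn.
    have c1 := cardsD1 (hole A) T; rewrite iT cT in c1.
    have c2 := cardsD1 x (T :\ hole A); rewrite in_setD1 xi xT in c2.
    by rewrite c1 c2 !add1n subn1 /= neq_ltn ltnSn.
  + by rewrite (setIidPr _) ?psiT ?cT -?leqNgt.
  have [a [le_at ai ax]] := other (hole A) x.
  have le_it := ltnW (ltT _ iT).
  apply/negP => /disjointFl/(_ (qQ _ le_at)).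
  rewrite /psi /= ltnNge le_ix /= !inE (subsetP sQA) ?qQ // orbT andbT negb_or.
  move/negP; apply; apply/andP; split; apply/eqP => /qI.
    by move=> /(_ le_at le_it) /eqP; apply/negP.
  by move=> /(_ le_at (ltT _ xT)) /eqP; apply/negP.
rewrite card_in_imset ?cardsX ?cT 1?mulnC //.
move=> [A x] [B y]; rewrite !in_setX /= => /andP[AF1 xT] /andP[BF1 yT] eqG.
have := psiT A x AF1 xT; rewrite eqG psiT // => /negb_inj eqlt.
have iT := holeT A AF1; have iA := holeA A AF1; have [_ _ sQA] := holeP A AF1.
have jT := holeT B BF1; have jB := holeA B BF1; have [_ _ sQB] := holeP B BF1.
move: eqG; rewrite /psi /= eqlt; case: ifP => lt_xi eqG; rewrite lt_xi in eqlt.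
  have out C u z : C \in F1 -> z \in T -> z \notin C :\ u -> z = hole C \/ z = u.
    move=> CF1 zT; rewrite in_setD1 negb_and negbK => /orP[/eqP|zC]; first by right.
    by left; apply/eqP; apply: contraNT zC; exact: inA.
  (* The points of [T] missing from the shadow are the hole and x; x < hole rules out a swap. *)
  have xy : hole A = hole B /\ x = y.
    have [//|ijB|ix] : [\/ hole A = hole B /\ x = y, hole B = x | hole A = y].
      have : hole B \notin A :\ x by rewrite eqG in_setD1 (negbTE jB) andbF.
      case/(out _ _ _ AF1 jT) => [ij|]; last by constructor 2.
      have : y \notin A :\ x by rewrite eqG in_setD1 eqxx.
      by case/(out _ _ _ AF1 yT) => [|yx]; [constructor 3 | constructor 1].
    - have : y \notin A :\ x by rewrite eqG in_setD1 eqxx.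
      case/(out _ _ _ AF1 yT) => e; rewrite e ijB in eqlt.
        by have := ltn_trans eqlt lt_xi; rewrite ltnn.
      by rewrite ltnn in eqlt.
    - have : x \notin B :\ y by rewrite -eqG in_setD1 eqxx.
      case/(out _ _ _ BF1 xT) => e; rewrite e ix in lt_xi.
        by have := ltn_trans eqlt lt_xi; rewrite ltnn.
      by rewrite ltnn in lt_xi.
  case: xy => ij xy; rewrite -xy in eqG *; congr (_, _).
  have xA : x \in A.
    by apply: inA => //; apply: contraTneq lt_xi => ->; rewrite ltnn.
  have xB : x \in B.
    by apply: inA => //; rewrite -ij; apply: contraTneq lt_xi => ->; rewrite ltnn.
  by rewrite -(setD1K xA) eqG setD1K.
have le_it := ltnW (ltT _ iT); have le_jt := ltnW (ltT _ jT).
have le_xt := ltT _ xT; have le_yt := ltT _ yT.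
have out (C : {set 'I_n}) (i : 'I_n) (a b c : nat) : Q \subset C -> c <= t -> a <= t -> b <= t ->
    q c \notin (i |: C) :\: [set q a; q b] -> c = a \/ c = b.
  move=> sQC le_ct le_at le_bt; rewrite in_setD in_set2 in_setU1.
  rewrite (subsetP sQC) ?qQ // orbT andbT negbK.
  by case/orP=> /eqP /qI-> //; [left | right].
have le_ix : hole A <= x by rewrite leqNgt lt_xi.
have le_jy : hole B <= y by rewrite leqNgt eqlt.
(* The missing petals have indices i and x+1; i < x+1 again rules out a swap. *)
have ij : hole A = hole B :> nat.
  have : q (hole B) \notin (hole A |: A) :\: [set q (hole A); q x.+1].
    by rewrite eqG in_setD in_set2 eqxx.
  case/out=> // jx.
  have : q y.+1 \notin (hole A |: A) :\: [set q (hole A); q x.+1].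
    by rewrite eqG in_setD in_set2 eqxx orbT.
  case/out=> // yx; have := leq_ltn_trans le_jy (ltnSn y).
    by rewrite yx jx ltnNge ltnW // ltnS.
  by rewrite yx jx ltnn.
have xy : x = y.
  have : q y.+1 \notin (hole A |: A) :\: [set q (hole A); q x.+1].
    by rewrite eqG in_setD in_set2 eqxx orbT.
  case/out=> // [yi|[yx]]; last exact/val_inj.
  by have := leq_ltn_trans le_jy (ltnSn y); rewrite yi ij ltnn.
move/val_inj in ij; rewrite -xy -ij in eqG jB *; congr (_, _).
(* The removed petals belong to both [A] and [B], the hole to neither; elsewhere the shadow
   decides. *)
apply/setP => z; have /setP/(_ z) := eqG; rewrite !in_setD.
have [|_] := boolP (z \in [set q (hole A); q x.+1]).
  move=> zq _; have zQ : z \in Q by move: zq; rewrite in_set2 => /orP[] /eqP ->; exact: qQ.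
  by rewrite (subsetP sQA) ?(subsetP sQB).
by rewrite /= !in_setU1; case: eqP => [->|] //; rewrite (negbTE iA) (negbTE jB).
Qed.

(** * Assembly of the shadow bound *)

Theorem corollary6p8 (n k t j : nat) (F : {set {set 'I_n}})
  (hj : 1 <= j) (hjt : j < t) (htk : t < k) (hkn : k < n)
  (hn : (k - t + 1) * (t + 1) <= n) (hkt : t + 2 <= k - t + 1)
  (hF : F \subset ksubsets n k)
  (hshift : shifted k F) (hint : t_intersecting t F)
  (hA1 : ~~ (F \subset family_A1 n k t))
  (hcard : t * 'C(n + t - 2 * k, k - t - 1)
             + \sum_(t + 2 <= l < k.+1) 'C(2 * k - t, l - t) * 'C(n, k - l)
           < #|F|) :
  'C(t, j) * #|F| < #|shadow k j F|.
Proof.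
(* As t+1 >= 2, (k-t+1)(t+1) >= 2(k-t) + t + 1 > 2k-t. *)
have le_Nn : 2 * k - t <= n by nia.
have le_tn : t <= n by lia.
have [B0 B0F cB0] : exists2 B, B \in F & #|B :&: initial n (t + 2)| <= t.
  have /subsetPn[B BF nB] := hA1; exists B => //; rewrite leqNgt.
  by apply: contra nB => lt_tB; rewrite inE (subsetP hF) // addn1.
have eN : n + t - 2 * k = n - (2 * k - t) by lia.
rewrite eN in hcard.
have [||Q [A0 [lt_tQ dQT [A0F sTA0 cA0Q] hsun]]] :=
  exists_sunflower hF hshift hint _ _ le_Nn (ex_intro2 _ _ B0 B0F cB0) hcard; try lia.
have cT := card_initial le_tn.
have [E [sE EP leE]] : exists E : {set {set 'I_n}}, [/\ E \subset shadow k j F,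
    forall G, G \in E -> #|G :&: initial n t| != t - j /\
      ~~ ((initial n t \subset G) && [disjoint G & Q]) &
    'C(t, j) * #|[set A in F | ~~ (initial n t \subset A)]| <= #|E|].
  have [le_j1|lt_1j] := leqP j 1.
    have -> : j = 1 by lia.
    by rewrite bin1; apply: extra_shadows_1 => //; lia.
  have := extra_shadows_ge2 hF lt_1j _ _ dQT hsun; rewrite cT.
  by apply; rewrite ltnW.
have := @shadow_card_gt n k j F E (initial n t) Q A0 hF hj; rewrite cT.
by apply=> //; lia.
Qed.
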